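(* Let $n\in\mathbb{Z}_{\geqslant 0}$ and $m\in\mathbb{N}$. For $j=1,2,3$ define \[ F_j(n,m):=\frac{\partial^j}{\partial x^j}\left\{\frac{\partial^m}{\partial z^m}\frac{\Gamma(x+1)\Gamma(z)}{\Gamma(x+z)}\right\}\bigg|_{x=n,\,z=1}. \] Then \[ \begin{aligned} \sum_{k=0}^{\infty}\frac{H_k^2-H_k^{(2)}}{(n+k+1)^{m+1}\binom{n+k}{k}} &=\frac{(-1)^{n-1}}{3}\sum_{k=1}^{n}\frac{(-1)^{k-1}}{k^m}\binom{n}{k}\Big\{H_n^3+2H_n^{(3)}+3H_nH_n^{(2)}\\ &\qquad\qquad -H_{n-k}^3-2H_{n-k}^{(3)}-3H_{n-k}H_{n-k}^{(2)}\Big\}\\ &\quad+\frac{(-1)^{m+n}}{m!}\Big\{\big(H_n^2+H_n^{(2)}\big)F_1(n,m)-H_nF_2(n,m)+\tfrac{1}{3}F_3(n,m)\Big\}. \end{aligned} \]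
   Context: $\Gamma$ is Euler's gamma function. $H_n^{(s)}=\sum_{j=1}^{n}j^{-s}$ are the generalized harmonic numbers, $H_n=H_n^{(1)}$, and $H_0^{(s)}=H_0=0$. $\binom{a}{b}$ denotes the usual binomial coefficient. $\mathbb{N}=\{1,2,\dots\}$. *)

(* Defs.v *)
From HB Require Import structures.
From mathcomp Require Export all_boot all_order all_algebra.
From mathcomp Require Export all_classical all_reals all_analysis.

Set Implicit Arguments.
Unset Strict Implicit.
Unset Printing Implicit Defensive.

Import Order.TTheory GRing.Theory Num.Theory.
Import numFieldNormedType.Exports.

Local Open Scope classical_set_scope.
Local Open Scope ring_scope.

(* Euler's integral; it is the gamma function only for 0 < x. This is the only
   range that matters below: near x = n >= 0 and z = 1, the arguments x + 1, z
   and x + z are all positive. *)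
Definition Gamma (R : realType) (x : R) : R :=
  \int[@lebesgue_measure R]_(t in `]0, +oo[) (t `^ (x - 1) * expR (- t)).

Definition genharm (R : realType) (s n : nat) : R :=
  \sum_(1 <= j < n.+1) (j%:R ^+ s)^-1.

Definition gammaQuot (R : realType) (x z : R) : R :=
  Gamma (x + 1) * Gamma z / Gamma (x + z).

Definition Fder (R : realType) (j n m : nat) : R :=
  derive1n j (fun x : R => derive1n m (fun z : R => gammaQuot x z) 1) n%:R.

(* Main.v *)
Require Import Defs.
From mathcomp Require Import all_boot all_order all_algebra.
From mathcomp Require Import all_classical all_reals all_analysis.
From mathcomp Require Import measurable_realfun ring lra.
Import Order.TTheory GRing.Theory Num.Theory.
Import numFieldNormedType.Exports.
Local Open Scope classical_set_scope.
Local Open Scope ring_scope.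

Set Implicit Arguments.
Unset Strict Implicit.
Unset Printing Implicit Defensive.

(** Put [G x z = Gamma (x + 1) * Gamma z / Gamma (x + z)], [(- x)_j =
    (- x)(1 - x)...(j - 1 - x)] and let [H_n], [H_n2] denote the harmonic
    numbers of order 1 and 2. For [x > -1] and [z > 0],
     [Gamma (x + 1) Gamma z / Gamma (x + z + 1) = sum_j (- x)_j / (j! (z + j))].
    When [-1 < x <= 0] both sides are nonincreasing in [z] (the left one because
    [Gamma] is log-convex, the right one because its coefficients are
    nonnegative), satisfy [(z + x + 1) f (z + 1) = z f z] and agree at [z = 1];
    such a function is unique. Both sides satisfy the same recurrence in [x],
    which gives the remaining [x]. Differentiating termwise,
      [(d/dz)^m G x 1 = (-1)^(m+1) m! sum_(j >= 1) (- x)_j / (j! j^m)],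
    and this series may be differentiated termwise in [x] near [n].
    The combination [(H_n^2 + H_n2) D p - H_n D^2 p + D^3 p / 3] at [x = n]
    equals [2 n! [e^3] (p (n + e) / ((1 + e)...(n + e)))] up to a multiple of
    [p n]. For [p = (- x)_j] with [j = n + 1 + k] the quotient is
    [(-1)^(n+1) e (1 - e)...(k - e)], whose [e^3] coefficient is
    [(-1)^(n+1) k! (H_k^2 - H_k2) / 2]: these terms form the series of the
    theorem. The terms with [j <= n] cancel the finite sum. *)

(** * The gamma function *)

Section GammaIntegral.
Context {R : realType}.
Local Notation mu := (@lebesgue_measure R).

Definition gamma_integrand (x t : R) : R := t `^ (x - 1) * expR (- t).

(** Extended-real values allow the functional equation to be proved before finiteness, which is then
    deduced from it. *)
Definition egamma (x : R) : \bar R :=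
  (\int[mu]_(t in `]0%R, +oo[) (gamma_integrand x t)%:E)%E.

Lemma gamma_integrand_ge0 x t : 0 <= gamma_integrand x t.
Proof. by rewrite mulr_ge0 ?powR_ge0 ?expR_ge0. Qed.

Lemma gamma_integrandE x t : 0 < t ->
  gamma_integrand x t = expR (ln t * (x - 1) - t).
Proof. by move=> t0; rewrite /gamma_integrand /powR gt_eqF// -expRD mulrC. Qed.

Lemma continuous_powR (p a : R) : 0 < a ->
  {for a, continuous (fun t : R => t `^ p)}.
Proof.
move=> a0; apply: differentiable_continuous; apply/derivable1_diffP.
by apply: derivable_powR; rewrite in_itv/= a0.
Qed.

Lemma continuous_expRN (a : R) : {for a, continuous (fun t : R => expR (- t))}.
Proof.
by apply: continuous_comp; [exact: continuousN|exact: continuous_expR].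
Qed.

Lemma continuous_powR_expR (p a : R) : 0 < a ->
  {for a, continuous (fun t : R => t `^ p * expR (- t))}.
Proof.
by move=> a0; apply: cvgM; [exact: continuous_powR|exact: continuous_expRN].
Qed.

Lemma measurable_gamma_integrand x :
  measurable_fun (`]0, +oo[%classic : set R) (gamma_integrand x).
Proof.
apply: open_continuous_measurable_fun => // t.
rewrite inE/= in_itv/= andbT => t0.
exact: continuous_powR_expR.
Qed.

Lemma egamma_ge0 x : (0 <= egamma x)%E.
Proof. by apply: integral_ge0 => t _; rewrite lee_fin gamma_integrand_ge0. Qed.

(** Compact intervals exhausting the half-line and avoiding the singularity at 0. The one of index 0
    is the single point 1, hence the index shifts below. *)
Let itvn (n : nat) : set R := `[n.+1%:R^-1, n.+1%:R].

Let itvn_cvg x :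
  (\int[mu]_(t in itvn n) (gamma_integrand x t)%:E)%E @[n --> \oo] --> egamma x.
Proof.
have -> : egamma x =
    (\int[mu]_(t in \bigcup_n itvn n) (gamma_integrand x t)%:E)%E.
  congr (integral _ _ _); apply/seteqP; split => t /=.
    rewrite in_itv/= andbT => t0.
    have [n ht] : exists n : nat, Num.max t t^-1 < n%:R.
      by exists (Num.bound (Num.max t t^-1));
        rewrite archi_boundP// le_max (ltW t0).
    exists n => //=; rewrite /itvn/= in_itv/=; move: ht; rewrite gt_max => /andP[h1 h2].
    have n0 : (0 : R) < n.+1%:R by rewrite ltr0n.
    rewrite -[t in X in X && _]invrK lef_pV2 ?posrE ?invr_gt0//.
    by rewrite -natr1 !ler_wpDr// ltW.
  move=> [n _]; rewrite /itvn/= !in_itv/= ?andbT => /andP[h _].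
  by apply: lt_le_trans h; rewrite invr_gt0 ltr0n.
apply: ge0_nondecreasing_set_cvg_integral.
- move=> i j ij; apply/subsetPset => t; rewrite /itvn/= !in_itv/= => /andP[h1 h2].
  apply/andP; split.
    by apply: le_trans h1; rewrite lef_pV2 ?posrE ?ltr0n// ler_nat.
  by apply: le_trans h2 _; rewrite ler_nat.
- by move=> n; rewrite /itvn.
- move=> i; apply/measurable_EFinP.
  apply: measurable_funS (measurable_gamma_integrand x) => //.
  move=> t; rewrite /itvn/= !in_itv/= ?andbT => /andP[h _].
  by apply: lt_le_trans h; rewrite invr_gt0 ltr0n.
- by move=> i t _; rewrite lee_fin gamma_integrand_ge0.
Qed.

Let itvn_parts p n : 0 < p ->
  (\int[mu]_(t in itvn n.+1) (gamma_integrand (p + 1) t)%:E =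
   (n.+2%:R^-1 `^ p * expR (- n.+2%:R^-1) - n.+2%:R `^ p * expR (- n.+2%:R))%:E
   + p%:E * \int[mu]_(t in itvn n.+1) (gamma_integrand p t)%:E)%E.
Proof.
move=> p0; set a := n.+2%:R^-1; set b := n.+2%:R.
have a0 : 0 < a by rewrite invr_gt0 ltr0n.
have b1 : 1 < b by rewrite /b ltr1n.
have ab : a < b by rewrite (lt_trans _ b1)// /a invf_lt1 ?ltr0n// ltr1n.
have gt0 t : t \in `[a, b] -> 0 < t.
  by rewrite in_itv/= => /andP[h _]; exact: lt_le_trans h.
have cw (f : R -> R) : (forall t, 0 < t -> {for t, continuous f}) ->
    {within `[a, b], continuous f}.
  move=> cf; apply: continuous_in_subspaceT => t; rewrite inE => tab.
  by apply/cf/gt0.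
have LR (f : R -> R) : (forall t, 0 < t -> derivable f t 1) ->
    derivable_oo_LRcontinuous f a b.
  move=> df; have cf t : 0 < t -> {for t, continuous f}.
    by move=> t0; apply: differentiable_continuous; apply/derivable1_diffP/df.
  split.
  - by move=> t; rewrite in_itv/= => /andP[h _]; apply/df/(lt_trans a0).
  - exact/cvg_at_right_filter/cf.
  - exact/cvg_at_left_filter/cf/(lt_trans a0).
have dP t : 0 < t -> derivable (fun t : R => t `^ p) t 1.
  by move=> t0; apply: derivable_powR; rewrite in_itv/= t0.
have dE t : 0 < t -> derivable (fun t : R => - expR (- t)) t 1.
  by move=> _; exact: ex_derive.
have := @integration_by_parts R (fun t => t `^ p) (fun t => - expR (- t))
  (fun t => p * t `^ (p - 1)) (fun t => expR (- t)) a b ab.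
move=> /(_ _ (LR _ dP) _ _ (LR _ dE) _).
rewrite /gamma_integrand -/(itvn _) addrK => ->; first last.
- move=> t tab; rewrite derive1E.
  have -> : 'D_1 (fun t : R => - expR (- t)) t = - - expR (- t).
    by rewrite derive_val mulrN1.
  by rewrite opprK.
- by apply: cw => t _; exact: continuous_expRN.
- move=> t tab; rewrite powR_derive1//.
  by move: tab; rewrite !in_itv/= andbT => /andP[h _]; apply: lt_trans h.
- by apply: cw => t t0; apply: cvgM; [exact: cvg_cst|exact: continuous_powR].
congr (_ + _)%E; first by congr EFin; ring.
rewrite -ge0_integralZl//=; last 4 first.
- exact: measurable_itv.
- apply/measurable_EFinP; apply: measurable_funS (measurable_gamma_integrand p) => //.
  by move=> t /= /gt0; rewrite in_itv/= andbT.
- by move=> t _; rewrite lee_fin; exact: gamma_integrand_ge0.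
- by rewrite lee_fin ltW.
rewrite -[RHS]oppeK; congr (- _)%E; rewrite -integral_ge0N; last first.
  by move=> t _; rewrite lee_fin !mulr_ge0 ?powR_ge0 ?expR_ge0 ?(ltW p0).
apply: eq_integral => t _.
by rewrite -EFinM -EFinN /gamma_integrand mulrN mulrA.
Qed.

(** Raising t / M <= exp (t / M) to the power M = p + 1 gives t^M <= M^M exp t. The one power of t
    beyond t^p leaves the decay 1 / t. *)
Lemma powR_expRN_le (p t : R) : 0 < p -> 0 < t ->
  t `^ p * expR (- t) <= (p + 1) `^ (p + 1) / t.
Proof.
move=> p0 t0; set M := p + 1; have M0 : 0 < M by rewrite addr_gt0.
have h : t `^ M <= M `^ M * expR t.
  have [u u0 ->] : exists2 u, 0 < u & t = M * u.
    by exists (t / M); rewrite ?divr_gt0// mulrC divfK ?gt_eqF.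
  rewrite powRM ?(ltW u0) ?(ltW M0)// ler_wpM2l ?powR_ge0// mulrC expRM.
  rewrite ge0_ler_powR ?nnegrE ?expR_ge0 ?(ltW u0) ?(ltW M0)//.
  by apply: ltW; apply: lt_le_trans (expR_ge1Dx _); rewrite ltrDr.
rewrite ler_pdivlMr// expRN mulrAC.
rewrite ler_pdivrMr ?expR_gt0//.
apply: le_trans h; rewrite /M powRD ?(gt_eqF t0) ?implybT//.
by rewrite powRr1// ltW.
Qed.

Let boundary_cvg0 (p : R) : 0 < p ->
  (n.+2%:R^-1 `^ p * expR (- n.+2%:R^-1) - n.+2%:R `^ p * expR (- n.+2%:R))
    @[n --> \oo] --> (0 : R).
Proof.
move=> p0; rewrite -[X in _ --> X]subr0; apply: cvgB.
  apply: (@squeeze_cvgr _ _ _ _ (cst 0) (fun n => n.+2%:R^-1 `^ p)).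
  - near=> n; rewrite mulr_ge0 ?powR_ge0 ?expR_ge0//=.
    by rewrite ler_piMr ?powR_ge0// expR_le1 oppr_le0 invr_ge0.
  - exact: cvg_cst.
  - move/cvg_at_rightP : (powR_cvg0 p0); apply; split => [n|].
      by rewrite invr_gt0.
    by have := @cvg_harmonic R; rewrite -cvg_shiftS.
apply: (@squeeze_cvgr _ _ _ _ (cst 0)
  (fun n => (p + 1) `^ (p + 1) * n.+2%:R^-1)).
- near=> n; rewrite mulr_ge0 ?powR_ge0 ?expR_ge0//=.
  by rewrite powR_expRN_le.
- exact: cvg_cst.
- rewrite -[X in _ --> X](mulr0 ((p + 1) `^ (p + 1))).
  apply: cvgM; first exact: cvg_cst.
  by have := @cvg_harmonic R; rewrite -cvg_shiftS.
Unshelve. all: by end_near. Qed.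

Lemma egammaS (p : R) : 0 < p -> egamma (p + 1) = (p%:E * egamma p)%E.
Proof.
move=> p0.
have h1 := @itvn_cvg (p + 1); rewrite -cvg_shiftS/= in h1.
have h2 := @itvn_cvg p; rewrite -cvg_shiftS/= in h2.
suff h3 : (\int[mu]_(t in itvn n.+1) (gamma_integrand (p + 1) t)%:E)%E
    @[n --> \oo] --> (p%:E * egamma p)%E.
  by rewrite -(cvg_lim _ h1)// (cvg_lim _ h3).
under eq_fun do rewrite (itvn_parts _ p0).
rewrite -[(p%:E * egamma p)%E]add0e; apply: cvgeD => //.
- by apply: cvg_EFin; [exact: nearW|exact: boundary_cvg0].
- exact: cvgeZl.
Qed.

Lemma egamma1 : egamma 1 = 1%E.
Proof.
transitivity (\int[mu]_(t in `[0%R, +oo[) (expR (- t))%:E)%E.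
  rewrite -integral_itv_obnd_cbnd; last first.
    apply/measurable_EFinP; apply: measurable_funTS.
    by apply: continuous_measurable_fun => t; exact: continuous_expRN.
  apply: eq_integral => t _.
  by rewrite /gamma_integrand subrr powRr0 mul1r.
rewrite (@ge0_continuous_FTC2y _ _ (fun t => - expR (- t)) _ 0)//.
- by rewrite oppr0 expR0 EFinN oppeK add0e.
- by apply: continuous_subspaceT => t; exact: continuous_expRN.
- by rewrite -oppr0; apply: cvgN; exact: cvgr_expR.
- by apply: cvgN; apply/cvg_at_right_filter; exact: continuous_expRN.
- by move=> t _; rewrite derive1E derive_val mulrN1 opprK.
Qed.

(** The functional equation yields finiteness at the positive integers, comparison extends it to
    arguments at least 1, and the functional equation read backwards covers the rest. *)
Lemma egamma_fin_num (x : R) : 0 < x -> egamma x \is a fin_num.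
Proof.
have fin_nat n : egamma n.+1%:R \is a fin_num.
  elim: n => [|n ih]; first by rewrite egamma1.
  by rewrite -natr1 egammaS ?ltr0n// fin_numM.
have fin_ge1 y : 1 <= y -> egamma y \is a fin_num.
  move=> y1; rewrite ge0_fin_numE ?egamma_ge0//.
  have [n hn] : exists n : nat, y < n%:R.
    by exists (Num.bound y); rewrite archi_boundP// (le_trans ler01).
  (* Pointwise t^(y-1) <= 1 + t^n: the first summand dominates for t <= 1, the second for t > 1. *)
  apply: (@le_lt_trans _ _ (egamma 1 + egamma n.+1%:R)%E); last first.
    apply: lte_add_pinfty; last by rewrite ltey_eq fin_nat.
    by rewrite egamma1 ltry.
  rewrite /egamma -ge0_integralD; last 5 first.
  - exact: measurable_itv.
  - by move=> t _; rewrite lee_fin gamma_integrand_ge0.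
  - apply/measurable_EFinP; exact: measurable_gamma_integrand.
  - by move=> t _; rewrite lee_fin gamma_integrand_ge0.
  - apply/measurable_EFinP; exact: measurable_gamma_integrand.
  apply: ge0_le_integral => //=.
  - by move=> t _; rewrite lee_fin gamma_integrand_ge0.
  - apply/measurable_EFinP; exact: measurable_gamma_integrand.
  - apply/measurable_EFinP.
    by apply: measurable_funD; exact: measurable_gamma_integrand.
  - move=> t; rewrite in_itv/= andbT => t0; rewrite -EFinD lee_fin.
    rewrite -mulrDl ler_wpM2r ?expR_ge0// subrr powRr0.
    have [t1|t1] := leP t 1.
      rewrite ler_wpDr ?powR_ge0//.
      rewrite -[leRHS](powRr0 t) ger_powR ?t0//.
      by rewrite subr_ge0.
    rewrite ler_wpDl// ler_powR ?(ltW t1)//.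
    by rewrite lerD2r -natr1 ler_wpDr// ltW.
move=> x0; have := fin_ge1 (x + 1); rewrite lerDr (ltW x0) => /(_ isT).
rewrite egammaS// !ge0_fin_numE ?egamma_ge0 ?mule_ge0 ?egamma_ge0 ?lee_fin ?ltW//.
move=> h; rewrite ltey; apply/eqP => hy; move: h.
by rewrite hy gt0_muley ?lte_fin// ltxx.
Qed.

Lemma egammaE (x : R) : 0 < x -> egamma x = (Gamma x)%:E.
Proof. by move=> x0; rewrite fineK// egamma_fin_num. Qed.

Lemma Gamma1 : Gamma (1 : R) = 1.
Proof. by apply: EFin_inj; rewrite -egammaE// egamma1. Qed.

Lemma GammaS (x : R) : 0 < x -> Gamma (x + 1) = x * Gamma x.
Proof.
move=> x0; apply: EFin_inj.
by rewrite EFinM -!egammaE ?addr_gt0// egammaS.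
Qed.

Lemma integrable_gamma_integrand (x : R) : 0 < x ->
  mu.-integrable `]0%R, +oo[ (EFin \o gamma_integrand x).
Proof.
move=> x0; apply/integrableP; split.
  apply/measurable_EFinP; exact: measurable_gamma_integrand.
under eq_integral do rewrite /= ger0_norm ?gamma_integrand_ge0//.
by rewrite -ge0_fin_numE ?egamma_ge0// egamma_fin_num.
Qed.

(** On [1, 2] the power t^(x-1) is at least 1 / t >= 1 / 2, because x > 0. *)
Lemma Gamma_gt0 (x : R) : 0 < x -> 0 < Gamma x.
Proof.
move=> x0; rewrite -lte_fin -egammaE//.
apply: (@lt_le_trans _ _
  (\int[mu]_(t in `[1%R, 2%R]) (2^-1 * expR (- 2))%:E)%E).
  rewrite integral_cst//= lebesgue_measure_itv/= lte_fin ltr1n -EFinD -EFinM.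
  by rewrite lte_fin !mulr_gt0 ?invr_gt0 ?expR_gt0// subr_gt0 ltr1n.
have sub : `[1%R, 2%R] `<=` (`]0%R, +oo[%classic : set R).
  move=> t; rewrite /= !in_itv/= andbT => /andP[h _].
  exact: lt_le_trans h.
apply: (@le_trans _ _
  (\int[mu]_(t in `[1%R, 2%R]) (gamma_integrand x t)%:E)%E); last first.
  apply: ge0_subset_integral => //.
  - apply/measurable_EFinP; exact: measurable_gamma_integrand.
  - by move=> t _; rewrite lee_fin gamma_integrand_ge0.
apply: ge0_le_integral => //=.
- apply/measurable_EFinP.
  exact: measurable_funS (measurable_gamma_integrand x).
- move=> t; rewrite in_itv/= => /andP[t1 t2]; rewrite lee_fin.
  rewrite ler_pM ?expR_ge0// ?ler_expR ?lerN2//.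
  apply: (@le_trans _ _ (t `^ (- 1))).
    rewrite powR_inv1 ?(le_trans ler01)// lef_pV2 ?posrE//.
    exact: lt_le_trans t1.
  by rewrite ler_powR// lerBrDr addNr ltW.
Qed.

(** Young's inequality: [K] is A^l D^(1-l), and convexity of exp is applied to the logarithms of the
    two integrands normalised by [A] and [D]. *)
Lemma gamma_integrand_convex (a d l t A D : R)
    (K := expR (l * ln A + (1 - l) * ln D)) :
  0 < t -> 0 <= l <= 1 -> 0 < A -> 0 < D ->
  gamma_integrand (l * a + (1 - l) * d) t <=
  K * l / A * gamma_integrand a t + K * (1 - l) / D * gamma_integrand d t.
Proof.
move=> t0 /andP[l0 l1] A0 D0; rewrite !gamma_integrandE//.
set u := ln t * (a - 1) - t; set v := ln t * (d - 1) - t.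
have -> : K * l / A * expR u + K * (1 - l) / D * expR v =
    K * (l * expR (u - ln A) + (1 - l) * expR (v - ln D)).
  rewrite (expRD u) (expRD v) !expRN !lnK ?posrE//.
  by field; rewrite !gt_eqF.
have -> : ln t * (l * a + (1 - l) * d - 1) - t =
    (l * ln A + (1 - l) * ln D) + (l * (u - ln A) + (1 - l) * (v - ln D)).
  by rewrite /u /v; ring.
rewrite expRD ler_wpM2l ?expR_ge0//.
have := @convex_expR R (Itv01 l0 l1) (u - ln A) (v - ln D).
by rewrite !convRE.
Qed.

Lemma integrable_scale_gamma_integrand (c x : R) : 0 < x ->
  mu.-integrable `]0%R, +oo[ (EFin \o (fun t => c * gamma_integrand x t)).
Proof.
move=> x0; rewrite (_ : EFin \o _ =
  (fun t => (c%:E * (EFin \o gamma_integrand x) t)%E))//.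
by apply: integrableZl => //; exact: integrable_gamma_integrand.
Qed.

(** Hölder's inequality: the pointwise Young bound is integrated with [A] and [D] equal to the two
    gamma values, and the right-hand side collapses to [K]. *)
Lemma Gamma_log_convex (a d l : R) : 0 < a -> 0 < d -> 0 <= l <= 1 ->
  Gamma (l * a + (1 - l) * d) <=
  expR (l * ln (Gamma a) + (1 - l) * ln (Gamma d)).
Proof.
move=> a0 d0 l01.
have pos : 0 < l * a + (1 - l) * d.
  case/andP: l01 => l0 l1.
  have [->|ln0] := eqVneq l 0; first by rewrite mul0r add0r subr0 mul1r.
  rewrite ltr_wpDr ?mulr_ge0 ?subr_ge0 ?(ltW d0)// mulr_gt0//.
  by rewrite lt_neqAle eq_sym ln0.
have ia c := @integrable_scale_gamma_integrand c _ a0.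
have id c := @integrable_scale_gamma_integrand c _ d0.
have le c1 c2 : (forall t, 0 < t -> gamma_integrand (l * a + (1 - l) * d) t <=
      c1 * gamma_integrand a t + c2 * gamma_integrand d t) ->
    Gamma (l * a + (1 - l) * d) <= c1 * Gamma a + c2 * Gamma d.
  move=> h; rewrite /Gamma -[X in _ <= X + _]RintegralZl//; last first.
    exact: integrable_gamma_integrand.
  rewrite -[X in _ <= _ + X]RintegralZl//; last exact: integrable_gamma_integrand.
  rewrite -RintegralD//.
  apply: le_Rintegral => //.
  - exact: integrable_gamma_integrand.
  - rewrite (_ : EFin \o _ = ((EFin \o (fun t => c1 * gamma_integrand a t)%R) \+
      (EFin \o (fun t => c2 * gamma_integrand d t)%R))%E)//.
    exact: integrableD.
  - by move=> t; rewrite /= in_itv/= andbT; exact: h.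
move: (Gamma_gt0 a0) (Gamma_gt0 d0) le; set A := Gamma a; set D := Gamma d.
move: A D => A D A0 D0 /(_ _ _ (fun t t0 =>
  @gamma_integrand_convex a d l t A D t0 l01 A0 D0)) /le_trans; apply.
set K := expR _.
by rewrite !divfK ?gt_eqF// -mulrDr addrC subrK mulr1.
Qed.

(** Both w and z + c are convex combinations of z and w + c, with swapped weights l and 1 - l.
    Multiplying the two log-convexity bounds gives Gamma w Gamma (z + c) <= Gamma z Gamma (w +
    c). *)
Lemma Gamma_quot_nonincr (c z w : R) : 0 < c -> 0 < z -> z <= w ->
  Gamma w / Gamma (w + c) <= Gamma z / Gamma (z + c).
Proof.
move=> c0 z0 zw.
have w0 := lt_le_trans z0 zw.
have [zc0 wc0] : 0 < z + c /\ 0 < w + c by rewrite !addr_gt0.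
rewrite ler_pdivrMr ?Gamma_gt0// mulrAC ler_pdivlMr ?Gamma_gt0//.
have e0 : 0 < w + c - z by lra.
pose l := c / (w + c - z).
have l0 : 0 <= l by rewrite divr_ge0 ?ltW.
have l1 : l <= 1 by rewrite ler_pdivrMr// mul1r; lra.
have h1 := @Gamma_log_convex z (w + c) l z0 wc0 _.
have h2 := @Gamma_log_convex z (w + c) (1 - l) z0 wc0 _.
rewrite l0 l1 in h1; rewrite subr_ge0 l1 lerBlDr lerDl l0 in h2.
move: (h1 isT) (h2 isT).
have -> : l * z + (1 - l) * (w + c) = w by rewrite /l; field; rewrite gt_eqF.
have -> : (1 - l) * z + (1 - (1 - l)) * (w + c) = z + c.
  by rewrite /l; field; rewrite gt_eqF.
move=> {}h1 {}h2.
move: (Gamma_gt0 z0) (Gamma_gt0 zc0) (Gamma_gt0 w0) (Gamma_gt0 wc0) h1 h2.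
move: (Gamma z) (Gamma (z + c)) (Gamma w) (Gamma (w + c)) => A B C D A0 B0 C0 D0.
move=> h1 h2; apply: (@le_trans _ _ _ _ _ (ler_pM (ltW C0) (ltW B0) h1 h2)).
rewrite -expRD -[leRHS]lnK ?posrE ?mulr_gt0// ler_expR lnM// le_eqVlt.
by apply/orP; left; apply/eqP; ring.
Qed.
End GammaIntegral.

(** * Series *)

Section SeriesCriteria.
Context {R : realType}.
Implicit Types (e v b : nat -> R).

Lemma telescope_majorant_cvg e v (J : nat) : (forall j, 0 <= v j) ->
  (forall j, (J <= j)%N -> `|e j| <= v j - v j.+1) -> cvgn [normed series e].
Proof.
move=> v0 ev; apply: nondecreasing_is_cvgn.
  by apply/nondecreasing_seqP => n; rewrite /= !seriesEnat/= big_nat_recr//= lerDl.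
exists (\sum_(0 <= j < J) `|e j| + v J) => _ [n _ <-]; rewrite /series/=.
have h k : \sum_(0 <= j < J + k) `|e j| <=
    \sum_(0 <= j < J) `|e j| + v J - v (J + k)%N.
  elim: k => [|k ih]; first by rewrite addn0 addrK.
  rewrite addnS big_nat_recr//=; have := ev (J + k)%N (leq_addr _ _); lra.
have [nJ|/ltnW Jn] := leqP n J.
  rewrite (big_cat_nat _ nJ)//= -addrA lerDl addr_ge0// sumr_ge0//.
have := h (n - J)%N; rewrite subnKC// => /le_trans; apply.
by rewrite gerDl oppr_le0.
Qed.

Lemma telescope_series_cvg e v : (forall j, e j = v j - v j.+1) ->
  v n @[n --> \oo] --> (0 : R) -> series e @ \oo --> v 0%N.
Proof.
move=> ev v0.
have -> : series e = (fun n => v 0%N - v n).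
  apply/funext => n; rewrite /series/=.
  elim: n => [|n ih]; first by rewrite big_geq// subrr.
  by rewrite big_nat_recr//= ih ev; ring.
by rewrite -[X in _ --> X]subr0; apply: cvgB => //; exact: cvg_cst.
Qed.

(* A form of Raabe's criterion: the condition says that [b] decays at least as
   fast as [j `^ (- y - 1)]. *)
Section Raabe.
Variables (b : nat -> R) (y : R) (J : nat).
Hypotheses (b0 : forall j, 0 <= b j) (y1 : -1 < y).
Hypothesis br : forall j, (J <= j)%N -> b j.+1 * j.+1%:R <= b j * (j%:R - y).

(** The hypothesis rearranges to (y + 1) b_j <= (j + 1) (b_j - b_(j+1)), which provides a
    telescoping majorant. *)
Let br' j : (J <= j)%N -> b j / j.+1%:R <= b j / (y + 1) - b j.+1 / (y + 1).
Proof.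
move=> /br h; have j0 : (0 : R) < j.+1%:R by rewrite ltr0n.
have y0 : 0 < y + 1 by rewrite -ltrBlDr sub0r.
rewrite -mulrBl ler_pdivlMr// mulrAC ler_pdivrMr// mulrBl.
by move: h; rewrite -!natr1; nra.
Qed.

Lemma raabe_summable : cvgn (series (fun j => b j / j.+1%:R)).
Proof.
apply: normed_cvg.
apply: (@telescope_majorant_cvg _ (fun j => b j / (y + 1)) J) => [j|j Jj].
  by rewrite divr_ge0// -lerBlDr sub0r ltW.
by rewrite ger0_norm ?divr_ge0// br'.
Qed.

Lemma raabe_cvg0 : b n @[n --> \oo] --> (0 : R).
Proof.
have y0 : 0 < y + 1 by rewrite -ltrBlDr sub0r.
have dec j : (J <= j)%N -> b j.+1 <= b j.
  move=> /br' h; rewrite -subr_ge0 -(pmulr_lge0 _ (x := (y + 1)^-1)) ?invr_gt0//.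
  by rewrite mulrBl (le_trans _ h)// divr_ge0.
have decm i j : (J <= i)%N -> (i <= j)%N -> b j <= b i.
  move=> Ji /subnKC <-; elim: (j - i)%N => [|k ih]; first by rewrite addn0.
  by rewrite addnS (le_trans _ ih)// dec// (leq_trans Ji)// leq_addr.
apply/cvgrPdist_lt => /= l l0.
(* If [b] stayed above [l], then 1 / (j + 1) <= b_j / (l (j + 1)) would be summable, contradicting
   the divergence of the harmonic series. *)
have [N JN bN] : exists2 N, (J <= N)%N & b N < l.
  apply: contrapT => hN.
  have {hN} bl j : (J <= j)%N -> l <= b j.
    by move=> Jj; rewrite leNgt; apply/negP => bj; apply: hN; exists j.
  apply: (@dvg_harmonic R); apply: normed_cvg.
  apply: (@telescope_majorant_cvg _ (fun j => b j / (y + 1) / l) J) => [j|j Jj].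
    by rewrite !divr_ge0// ltW.
  rewrite ger0_norm ?harmonic_ge0// -mulrBl ler_pdivlMr//.
  apply: le_trans (br' Jj); rewrite mulrC ler_wpM2r ?invr_ge0//.
  exact: bl.
near=> n; rewrite sub0r normrN ger0_norm//.
apply: le_lt_trans bN; apply: decm => //.
by near: n; exact: nbhs_infty_ge.
Unshelve. all: by end_near. Qed.

End Raabe.
End SeriesCriteria.

(** * The beta series and its recurrences *)

Section BetaSeries.
Context {R : realType}.

(* [rfact j x] is the rising factorial [(- x)(1 - x)...(j - 1 - x)] and
   [bcoef j x] is the coefficient of [t ^+ j] in [(1 - t) `^ x]. *)
Definition rfact (j : nat) (x : R) : R := \prod_(i < j) (i%:R - x).
Definition bcoef (j : nat) (x : R) : R := rfact j x / j`!%:R.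

Lemma bcoef0 x : bcoef 0 x = 1.
Proof. by rewrite /bcoef /rfact big_ord0 fact0 divr1. Qed.

Lemma fact_neq0 (j : nat) : j`!%:R != 0 :> R.
Proof. by rewrite pnatr_eq0 -lt0n fact_gt0. Qed.

Lemma bcoefS j x : bcoef j.+1 x * j.+1%:R = bcoef j x * (j%:R - x).
Proof.
rewrite /bcoef /rfact big_ord_recr/= factS natrM.
by field; rewrite fact_neq0 addrC natr1 pnatr_eq0.
Qed.

(** Up to the factorial, both sides are [rfact j.+1 (x + 1)], with its last or its first factor
    split off. *)
Lemma bcoef_addr1 j x : bcoef j (x + 1) * (j%:R - 1 - x) = - (x + 1) * bcoef j x.
Proof.
have h1 : rfact j.+1 (x + 1) = rfact j (x + 1) * (j%:R - (x + 1)).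
  by rewrite /rfact big_ord_recr.
have h2 : rfact j.+1 (x + 1) = - (x + 1) * rfact j x.
  rewrite /rfact big_ord_recl/= sub0r; congr (_ * _).
  by apply: eq_bigr => i _; rewrite /bump/= add1n -natr1; ring.
by rewrite /bcoef mulrAC mulrA -h2 h1; congr (_ / _); ring.
Qed.

(** Past |x| the factor j - x is nonnegative, so norms can be taken in [bcoefS]; this is Raabe's
    condition with y = x. *)
Lemma bcoef_norm_ratio (x : R) : exists J, forall j, (J <= j)%N ->
  `|bcoef j.+1 x| * j.+1%:R <= `|bcoef j x| * (j%:R - x).
Proof.
exists (Num.bound `|x|) => j Jj.
have xj : x <= j%:R.
  apply: le_trans (ler_norm x) _; apply: le_trans (ltW (archi_boundP _)) _ => //.
  by rewrite ler_nat; apply: leq_trans Jj.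
rewrite -[j.+1%:R]ger0_norm// -normrM bcoefS normrM.
by rewrite [X in _ * X]ger0_norm// subr_ge0.
Qed.

Lemma cvg_bcoef0 x : -1 < x -> bcoef n x @[n --> \oo] --> (0 : R).
Proof.
move=> x1; have [J hJ] := bcoef_norm_ratio x.
exact/norm_cvg0P/(raabe_cvg0 _ x1 hJ).
Qed.

Lemma bcoef_summable x : -1 < x ->
  cvgn (series (fun j => `|bcoef j x| / j.+1%:R)).
Proof.
move=> x1; have [J hJ] := bcoef_norm_ratio x.
by apply: (raabe_summable _ x1 hJ).
Qed.

Definition beta_term (x z : R) (j : nat) : R := bcoef j x / (z + j%:R).
Definition beta_series (x z : R) : R := limn (series (beta_term x z)).

Lemma normed_beta_series_cvg x z : -1 < x -> 0 < z ->
  cvgn [normed series (beta_term x z)].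
Proof.
move=> x1 z0.
apply: (@series_le_cvg _ (fun j => `|beta_term x z j|)
  (fun j => (1 + z^-1) * (`|bcoef j x| / j.+1%:R))) => //.
- by move=> j; rewrite mulr_ge0 ?divr_ge0 ?addr_ge0 ?invr_ge0 ?(ltW z0).
- move=> j /=; have zj : 0 < z + j%:R by rewrite ltr_wpDr.
  rewrite normrM mulrCA ler_wpM2l// gtr0_norm ?invr_gt0//.
  rewrite -[leLHS]mul1r ler_pdivrMr// mulrAC ler_pdivlMr ?ltr0n//.
  have -> : (1 + z^-1) * (z + j%:R) = j%:R + 1 + (z + z^-1 * j%:R).
    by field; rewrite gt_eqF.
  by rewrite mul1r -natr1 lerDl addr_ge0 ?mulr_ge0 ?invr_ge0 ?(ltW z0).
- exact/is_cvg_seriesZ/bcoef_summable.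
Qed.

Lemma beta_series_cvg x z : -1 < x -> 0 < z -> cvgn (series (beta_term x z)).
Proof. by move=> x1 z0; exact/normed_cvg/normed_beta_series_cvg. Qed.

(** By [bcoefS] the terms are the successive differences of [bcoef j x / (x + 1)]. *)
Lemma beta_series1 x : -1 < x -> beta_series x 1 = (x + 1)^-1.
Proof.
move=> x1; have y0 : x + 1 != 0 by rewrite gt_eqF//; lra.
apply/cvg_lim => //.
have -> : (x + 1)^-1 = bcoef 0 x / (x + 1) by rewrite bcoef0 mul1r.
apply: (@telescope_series_cvg _ _ (fun j => bcoef j x / (x + 1))).
  move=> j; have h := bcoefS j x.
  have j0 : 1 + j%:R != 0 :> R by rewrite addrC natr1 pnatr_eq0.
  rewrite /beta_term; apply: (mulIf y0); apply: (mulIf j0).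
  rewrite -mulrBl divfK// mulrBl [1 + _ in X in _ = _ - X]addrC natr1 h.
  by field.
rewrite -[X in _ --> X](mul0r (x + 1)^-1).
by apply: cvgM; [exact: cvg_bcoef0|exact: cvg_cst].
Qed.

Lemma lim_seriesD_scale (f g : nat -> R) (a b : R) :
  cvgn (series f) -> cvgn (series g) ->
  series (fun j => a * f j + b * g j) @ \oo -->
    a * limn (series f) + b * limn (series g).
Proof.
move=> cf cg.
have -> : series (fun j => a * f j + b * g j) =
    (fun n => a * series f n + b * series g n).
  by apply/funext => n; rewrite /series/= big_split/= !mulr_sumr.
by apply: cvgD; apply: cvgM => //; exact: cvg_cst.
Qed.

(** The difference of the two sides telescopes termwise along [j%:R * beta_term x z j], which
    vanishes at j = 0 and in the limit. *)
Lemma beta_series_addz1 x z : -1 < x -> 0 < z ->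
  (z + (x + 1)) * beta_series x (z + 1) = z * beta_series x z.
Proof.
move=> x1 z0; have z10 : 0 < z + 1 by rewrite addr_gt0.
have := @lim_seriesD_scale _ _ (z + (x + 1)) (- z)
  (beta_series_cvg x1 z10) (beta_series_cvg x1 z0).
rewrite -!/(beta_series _ _) mulNr => /cvg_lim h.
apply/eqP; rewrite -subr_eq0 -h//; apply/eqP/cvg_lim => //.
pose u j := j%:R * beta_term x z j.
have -> : (0 : R) = u 0%N by rewrite /u mul0r.
apply: telescope_series_cvg => [j|].
  have h1 := bcoefS j x; rewrite /u /beta_term.
  have zj : z + j%:R != 0 by rewrite gt_eqF// ltr_wpDr.
  have zj1 : z + 1 + j%:R != 0 by rewrite gt_eqF// ltr_wpDr.
  rewrite [j.+1%:R * _]mulrA [j.+1%:R * _]mulrC h1 -natr1.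
  by field; rewrite zj andbT (addrC j%:R) addrA zj1.
apply/norm_cvg0P.
apply: (@squeeze_cvgr _ _ _ _ (cst 0) (fun n => `|bcoef n x|)).
- near=> n; rewrite normr_ge0/= /u /beta_term mulrCA normrM ler_piMr//.
  have zn : 0 < z + n%:R by rewrite ltr_wpDr.
  rewrite ger0_norm ?divr_ge0 ?(ltW zn)// ler_pdivrMr// mul1r.
  by rewrite lerDr ltW.
- exact: cvg_cst.
- exact/norm_cvg0P/cvg_bcoef0.
Unshelve. all: by end_near. Qed.

(** Dividing (1 - t)^(x+1) by 1 - t replaces its coefficients by their partial sums. *)
Lemma series_bcoef_addr1 x n : series (bcoef ^~ (x + 1)) n.+1 = bcoef n x.
Proof.
rewrite /series/=; elim: n => [|n ih]; first by rewrite big_nat1 !bcoef0.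
rewrite big_nat_recr//= ih; have n0 : n.+1%:R != 0 :> R by rewrite pnatr_eq0.
have h1 := bcoefS n x; have h2 := bcoefS n (x + 1); have h3 := bcoef_addr1 n x.
apply: (mulIf n0); rewrite mulrDl h1 h2.
have -> : bcoef n (x + 1) * (n%:R - (x + 1)) = - (x + 1) * bcoef n x.
  by rewrite -h3; ring.
by rewrite -natr1; ring.
Qed.

(** By [bcoef_addr1] the numerators of the termwise difference acquire the factor z + j, which
    cancels the denominator. What remains is the series of [bcoef ^~ (x + 1)], of sum 0. *)
Lemma beta_series_addx1 x z : -1 < x -> 0 < z ->
  (z + (x + 1)) * beta_series (x + 1) z = (x + 1) * beta_series x z.
Proof.
move=> x1 z0; have x11 : -1 < x + 1 by lra.
have := @lim_seriesD_scale _ _ (z + (x + 1)) (- (x + 1))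
  (beta_series_cvg x11 z0) (beta_series_cvg x1 z0).
rewrite -!/(beta_series _ _) mulNr => /cvg_lim h.
apply/eqP; rewrite -subr_eq0 -h//; apply/eqP/cvg_lim => //.
have -> : (fun j => (z + (x + 1)) * beta_term (x + 1) z j
    + - (x + 1) * beta_term x z j) = bcoef ^~ (x + 1).
  apply/funext => j; rewrite /beta_term mulrA [X in _ + X]mulrA -bcoef_addr1.
  by field; rewrite gt_eqF// ltr_wpDr.
rewrite -cvg_shiftS; under eq_fun do rewrite series_bcoef_addr1.
exact: cvg_bcoef0.
Qed.

Lemma bcoef_ge0 j x : x <= 0 -> 0 <= bcoef j x.
Proof.
move=> x0; rewrite divr_ge0// prodr_ge0// => i _.
by rewrite subr_ge0 (le_trans x0).
Qed.

Lemma beta_series_nonincr x z w : -1 < x -> x <= 0 -> 0 < z -> z <= w ->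
  beta_series x w <= beta_series x z.
Proof.
move=> x1 x0 z0 zw; have w0 := lt_le_trans z0 zw.
apply: lim_series_le; [exact: beta_series_cvg..|] => j.
rewrite ler_wpM2l ?bcoef_ge0// lef_pV2 ?posrE ?ltr_wpDr//.
by rewrite lerD2r.
Qed.

End BetaSeries.

(** * The gamma ratio as a beta series *)

Section GammaBeta.
Context {R : realType}.

(* The ratio of two solutions is 1-periodic, and monotonicity squeezes it
   between [k / (k + a)] and [(k + a) / k] for all large [k]. *)
Lemma nonincr_recurrence_unique (a : R) (f g : R -> R) : 0 < a ->
  (forall z, 0 < z -> 0 < g z) ->
  (forall z w, 0 < z -> z <= w -> f w <= f z) ->
  (forall z w, 0 < z -> z <= w -> g w <= g z) ->
  (forall z, 0 < z -> (z + a) * f (z + 1) = z * f z) ->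
  (forall z, 0 < z -> (z + a) * g (z + 1) = z * g z) ->
  f 1 = g 1 -> forall z, 0 < z -> f z = g z.
Proof.
move=> a0 g0 fmon gmon fS gS fg1 z z0.
have fgn k : f k.+1%:R = g k.+1%:R.
  elim: k => // k ih; have k0 : (0 : R) < k.+1%:R by rewrite ltr0n.
  have ka : k.+1%:R + a != 0 by rewrite gt_eqF// addr_gt0.
  by apply: (mulfI ka); rewrite -[k.+2%:R]natr1 fS// gS// ih.
(* The ratio f / g is constant along z, z + 1, z + 2, ... *)
have cross N : f (z + N%:R) * g z = f z * g (z + N%:R).
  elim: N => [|N ih]; first by rewrite addr0.
  have zN : 0 < z + N%:R by rewrite ltr_wpDr.
  have zNa : z + N%:R + a != 0 by rewrite gt_eqF// addr_gt0.
  apply: (mulfI zNa); rewrite -natr1 addrA mulrA fS// mulrCA gS//.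
  by rewrite -mulrA ih mulrCA.
(* A fixed gap times every [N] stays bounded, so the gap is zero by the Archimedean property. *)
have bound N : `|f z - g z| * N%:R <= a * (g z + `|f z|).
  case: N => [|N].
    by rewrite mulr0 mulr_ge0 ?addr_ge0 ?(ltW a0) ?(ltW (g0 _ z0)).
  (* The point z + N + 1 is enclosed by the integers k + 1 and k + 2, where f and g agree. *)
  have /andP[t1 t2] := truncn_itv (ltW z0).
  set k := (Num.truncn z + N)%N.
  have kz : k.+1%:R <= z + N.+1%:R by rewrite /k -addnS natrD lerD2r.
  have zk : z + N.+1%:R <= k.+2%:R.
    by rewrite /k -addSn -addnS natrD lerD2r ltW.
  have k0 : (0 : R) < k.+1%:R by rewrite ltr0n.
  have zN : 0 < z + N.+1%:R by rewrite ltr_wpDr.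
  have Nk : N.+1%:R <= k.+1%:R :> R by rewrite ler_nat ltnS leq_addl.
  have [gz gzN] := (g0 _ z0, g0 _ zN).
  have h1 : f (z + N.+1%:R) <= g k.+1%:R by rewrite -fgn fmon.
  have h2 : g k.+2%:R <= f (z + N.+1%:R) by rewrite -fgn fmon.
  have h3 : g (z + N.+1%:R) <= g k.+1%:R by rewrite gmon.
  have h4 : g k.+2%:R <= g (z + N.+1%:R) by rewrite gmon.
  have h5 : (k.+1%:R + a) * g k.+2%:R = k.+1%:R * g k.+1%:R.
    by rewrite -[k.+2%:R]natr1 gS.
  have up : k.+1%:R * f z <= (k.+1%:R + a) * g z.
    rewrite -(ler_pM2r gzN) -[leLHS]mulrA -cross [leLHS]mulrA.
    apply: (@le_trans _ _ (k.+1%:R * g k.+1%:R * g z)).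
      by rewrite ler_pM2r// ler_pM2l.
    rewrite -h5 -!mulrA ler_pM2l ?addr_gt0// [leRHS]mulrC.
    by rewrite ler_pM2r.
  have lo : k.+1%:R * g z <= (k.+1%:R + a) * f z.
    rewrite -(ler_pM2r gzN) -[leRHS]mulrA -cross mulrAC [leRHS]mulrA.
    rewrite ler_pM2r//.
    apply: (@le_trans _ _ (k.+1%:R * g k.+1%:R)); first by rewrite ler_pM2l.
    by rewrite -h5 ler_pM2l ?addr_gt0.
  apply: (@le_trans _ _ (`|f z - g z| * k.+1%:R)); first by rewrite ler_wpM2l.
  have fn := ler_norm (f z); have an : a * f z <= a * `|f z| by rewrite ler_pM2l.
  have an0 : 0 <= a * `|f z| by rewrite mulr_ge0// ltW.
  have ag0 : 0 <= a * g z by rewrite mulr_ge0// ltW.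
  move: up lo; rewrite !mulrDl !mulrDr => up lo.
  have [h|/ltW h] := leP (f z - g z) 0.
    by rewrite ler0_norm//; lra.
  by rewrite ger0_norm//; lra.
apply/eqP; rewrite -subr_eq0 -normr_eq0; apply/negPn/negP => d0.
have {}d0 : 0 < `|f z - g z| by rewrite lt_neqAle eq_sym d0 normr_ge0.
set C := a * _ in bound.
have C0 : 0 <= C by have := bound 0%N; rewrite mulr0.
have := archi_boundP (divr_ge0 C0 (ltW d0)); rewrite ltr_pdivrMr// mulrC.
by rewrite ltNge bound.
Qed.

Lemma Gamma_beta_series (x z : R) : -1 < x -> 0 < z ->
  Gamma (x + 1) * Gamma z / Gamma (z + (x + 1)) = beta_series x z.
Proof.
suff H (n : nat) (u v : R) : -1 < u -> u <= n%:R -> 0 < v ->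
    Gamma (u + 1) * Gamma v / Gamma (v + (u + 1)) = beta_series u v.
  move=> x1 z0; apply: (H (Num.bound `|x|)) => //.
  apply: le_trans (ler_norm x) _; exact/ltW/archi_boundP.
elim: n u v => [|n ih] {}x {}z x1 xn z0.
  set a := x + 1; have a0 : 0 < a by rewrite /a; lra.
  have Ga := Gamma_gt0 a0.
  symmetry; move: z z0.
  apply: (@nonincr_recurrence_unique a) => //.
  - move=> z z0; have za0 : 0 < z + a by exact: addr_gt0.
    by rewrite divr_gt0 ?mulr_gt0 ?Gamma_gt0.
  - by move=> z w; exact: beta_series_nonincr.
  - move=> z w z0 zw; rewrite -!mulrA ler_pM2l//; exact: Gamma_quot_nonincr.
  - by move=> z z0; exact: beta_series_addz1.
  - move=> z z0; have za0 : 0 < z + a by rewrite addr_gt0.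
    rewrite addrAC (GammaS z0) (GammaS za0); move: (Gamma_gt0 za0).
    move: (Gamma (z + a)) (Gamma z) (Gamma a) => A B C A0.
    by field; rewrite !gt_eqF.
  - rewrite beta_series1// Gamma1 mulr1 (addrC 1) (GammaS a0) -/a.
    by rewrite invfM mulrCA mulfV ?mulr1// gt_eqF.
(* In the remaining case x > n >= 0, so x - 1 > -1 and the induction hypothesis applies to x - 1. *)
have [xn'|nx] := lerP x n%:R; first exact: ih.
have y1 : -1 < x - 1 by have := ler0n R n; lra.
have yn : x - 1 <= n%:R by rewrite lerBlDr natr1.
have := ih _ _ y1 yn z0; rewrite subrK => h.
have x0 : 0 < x by have := ler0n R n; lra.
have zx0 : 0 < z + x by rewrite addr_gt0.
have := beta_series_addx1 y1 z0; rewrite !subrK -h => h2.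
have zx : z + x != 0 by rewrite gt_eqF.
apply: (mulfI zx); rewrite h2 addrA (GammaS x0) (GammaS zx0).
move: (Gamma_gt0 zx0); move: (Gamma (z + x)) (Gamma z) (Gamma x) => A B C A0.
by field; rewrite !gt_eqF.
Qed.

Lemma gammaQuotE (x z : R) : -1 < x -> 0 < z -> 0 < x + z ->
  gammaQuot x z = (x + z) * beta_series x z.
Proof.
move=> x1 z0 xz0; rewrite -Gamma_beta_series// addrCA addrA (GammaS xz0).
rewrite /gammaQuot; move: (Gamma_gt0 xz0).
move: (Gamma (x + z)) (Gamma z) (Gamma (x + 1)) => A B C A0.
by field; rewrite !gt_eqF.
Qed.

End GammaBeta.

(** * Termwise differentiation of series *)

Section TermwiseDerivative.
Context {R : realType}.

(** The mean value theorem is used for [f], then for [f1] between x and the intermediate point;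
    hence the constant M instead of Lagrange's M / 2. *)
Lemma taylor2_le (f f1 f2 : R -> R) (x0 r M x y : R) :
  (forall t, `|t - x0| < r -> is_derive t 1 f (f1 t)) ->
  (forall t, `|t - x0| < r -> is_derive t 1 f1 (f2 t)) ->
  (forall t, `|t - x0| < r -> `|f2 t| <= M) ->
  `|x - x0| < r -> `|y - x0| < r ->
  `|f y - f x - f1 x * (y - x)| <= M * (y - x) ^+ 2.
Proof.
move=> df df1 f2M xr yr.
have ballP t a b : `|a - x0| < r -> `|b - x0| < r -> a <= t <= b -> `|t - x0| < r.
  by rewrite !ltr_norml => /andP[a1 a2] /andP[b1 b2] /andP[t1 t2]; lra.
have mvt (g dg : R -> R) a b :
    (forall t, `|t - x0| < r -> is_derive t 1 g (dg t)) ->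
    `|a - x0| < r -> `|b - x0| < r ->
    exists c, [/\ `|c - x0| < r, `|c - a| <= `|b - a| &
      g b - g a = dg c * (b - a)].
  move=> dgE.
  have aux u v : u <= v -> `|u - x0| < r -> `|v - x0| < r ->
      exists c, [/\ u <= c <= v, `|c - x0| < r & g v - g u = dg c * (v - u)].
    move=> uv ur vr.
    have [||c] := @MVT_segment R g dg u v uv.
    - move=> t; rewrite in_itv/= => /andP[t1 t2]; apply: dgE.
      by apply: (ballP _ u v) => //; rewrite !ltW.
    - apply: derivable_within_continuous => t; rewrite in_itv/= => tuv.
      by have [] := dgE t (ballP _ _ _ ur vr tuv).
    - rewrite in_itv/= => cuv; exists c; split => //; exact: (ballP _ u v).
  move=> ar br; have [ab|/ltW ba] := leP a b.
    have [c [/andP[c1 c2] cr e]] := aux _ _ ab ar br; exists c; split => //.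
    by rewrite !ger0_norm ?subr_ge0// lerD2r.
  have [c [/andP[c1 c2] cr e]] := aux _ _ ba br ar; exists c; split => //.
    by rewrite !ler0_norm ?subr_le0// !opprB lerD2l lerN2.
  by rewrite -opprB e -mulrN opprB.
have [c [cr cx ->]] := mvt _ _ x y df xr yr.
have [d [dr _ e]] := mvt _ _ x c df1 xr cr.
rewrite -mulrBl e -(real_normK (num_real (y - x))) expr2 mulrA !normrM.
by rewrite ler_wpM2r// ler_pM// f2M.
Qed.

Lemma lim_seriesZ_real (f : nat -> R) (k : R) : cvgn (series f) ->
  series (fun j => k * f j) @ \oo --> k * limn (series f).
Proof.
move=> cf; have -> : series (fun j => k * f j) = (fun n => k * series f n).
  by apply/funext => n; rewrite /series/= mulr_sumr.
by apply: cvgM => //; exact: cvg_cst.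
Qed.

(** The Taylor errors of the terms are at most M_j (y - x)^2. Their sum is therefore O((y - x)^2),
    so the error of the difference quotient is linear in y - x. *)
Lemma is_derive_series (f f1 f2 : nat -> R -> R) (M : nat -> R) (x0 r x : R) :
  (forall j t, `|t - x0| < r -> is_derive t 1 (f j) (f1 j t)) ->
  (forall j t, `|t - x0| < r -> is_derive t 1 (f1 j) (f2 j t)) ->
  (forall j t, `|t - x0| < r -> `|f2 j t| <= M j) -> cvgn (series M) ->
  (forall t, `|t - x0| < r -> cvgn (series (f ^~ t))) ->
  (forall t, `|t - x0| < r -> cvgn (series (f1 ^~ t))) ->
  `|x - x0| < r ->
  is_derive x 1 (fun t => limn (series (f ^~ t))) (limn (series (f1 ^~ x))).
Proof.
move=> df df1 f2M cM cf cf1 xr; set F := fun t => limn _; set l := limn _.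
have xr' : 0 < r - `|x - x0| by rewrite subr_gt0.
have est y : `|y - x0| < r ->
    `|F y - F x - l * (y - x)| <= limn (series M) * (y - x) ^+ 2.
  move=> yr.
  pose e j := f j y - f j x - f1 j x * (y - x).
  have eM j : `|e j| <= (y - x) ^+ 2 * M j.
    rewrite mulrC; apply: (taylor2_le (df j) (df1 j)) => // t tr; exact: f2M.
  have M0 j : 0 <= M j by exact: le_trans (f2M j x xr).
  have cM2 := @lim_seriesZ_real _ ((y - x) ^+ 2) cM.
  have ce : cvgn [normed series e].
    apply: (@series_le_cvg _ (fun j => `|e j|) (fun j => (y - x) ^+ 2 * M j)) => //.
      by move=> j; rewrite mulr_ge0// sqr_ge0.
    by apply/cvg_ex; exists ((y - x) ^+ 2 * limn (series M)).
  have ElimE : limn (series e) = F y - F x - l * (y - x).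
    apply/cvg_lim => //.
    have -> : series e = (fun n => series (f ^~ y) n - series (f ^~ x) n
        - series (f1 ^~ x) n * (y - x)).
      by apply/funext => n; rewrite /series/= mulr_suml -!sumrB.
    apply: cvgB; first by apply: cvgB; exact: cf.
    by apply: cvgM; [exact: cf1|exact: cvg_cst].
  rewrite -ElimE (le_trans (lim_series_norm ce))// mulrC -(cvg_lim _ cM2)//.
  apply: lim_series_le => //.
  by apply/cvg_ex; exists ((y - x) ^+ 2 * limn (series M)).
have cv : h^-1 *: ((F \o shift x) (h *: 1) - F x) @[h --> 0^'] --> l.
  rewrite -[l]add0r.
  apply: (@cvg_trans _ ((fun h =>
    (h^-1 *: ((F \o shift x) (h *: 1) - F x) - l) + l) @ 0^')).
    by apply: near_eq_cvg; near=> h; rewrite subrK.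
  apply: cvgD; last exact: cvg_cst.
  apply: (cvg_to_0_linear xr') => h /andP[h0 hr]; rewrite normr_gt0 in h0.
  have yr : `|h + x - x0| < r.
    by rewrite -addrA (le_lt_trans (ler_normD _ _))// -ltrBrDr.
  have := est _ yr; rewrite addrK => hE.
  rewrite /= [h *: 1]mulr1 /GRing.scale/=.
  have -> : h^-1 * (F (h + x) - F x) - l = h^-1 * (F (h + x) - F x - l * h).
    by field.
  rewrite normrM normfV mulrC ler_pdivrMr ?normr_gt0//.
  rewrite -mulrA -expr2 real_normK ?num_real//; exact: hE.
apply: DeriveDef; first by apply/cvg_ex; exists l.
exact/cvg_lim.
Unshelve. all: by end_near. Qed.

Lemma near_eq_derive1n (f g : R -> R) (a : R) k :
  {near a, f =1 g} -> {near a, derive1n k f =1 derive1n k g}.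
Proof.
move=> fg; elim: k => [|k ih]; first by rewrite !derive1n0.
have ih' := near_join ih.
near=> y; rewrite !derive1nS !derive1E.
by apply: near_eq_derive; near: y.
Unshelve. all: by end_near. Qed.

(** The first index of [f] is the order of differentiation. Passing from order k to k + 1 uses the
    majorant of order k + 2, which controls the Taylor remainder. *)
Lemma derive1n_series (f : nat -> nat -> R -> R) (M : nat -> nat -> R)
    (x0 r x : R) k :
  (forall i j t, `|t - x0| < r -> is_derive t 1 (f i j) (f i.+1 j t)) ->
  (forall i j t, `|t - x0| < r -> `|f i j t| <= M i j) ->
  (forall i, cvgn (series (M i))) -> `|x - x0| < r ->
  derive1n k (fun t => limn (series (f 0%N ^~ t))) x = limn (series (f k ^~ x)).
Proof.
move=> df fM cM.
have cf i t : `|t - x0| < r -> cvgn (series (f i ^~ t)).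
  move=> tr; apply: normed_cvg.
  apply: (@series_le_cvg _ (fun j => `|f i j t|) (M i)) => // j.
    exact: le_trans (fM i j t tr).
  exact: fM.
elim: k x => [|k ih] x xr; first by rewrite derive1n0.
rewrite derive1nS derive1E.
have d := @is_derive_series (f k) (f k.+1) (f k.+2) (M k.+2) x0 r x
  (df k) (df k.+1) (fM k.+2) (cM _) (cf k) (cf k.+1) xr.
rewrite (@near_eq_derive _ _ _ _ (fun t => limn (series (f k ^~ t)))).
  by case: d.
have xr' : 0 < r - `|x - x0| by rewrite subr_gt0.
near=> y; apply: ih.
rewrite -(subrK x y) -addrA (le_lt_trans (ler_normD _ _))// -ltrBrDr distrC.
by near: y; exact: nbhsx_ballx.
Unshelve. all: by end_near. Qed.

End TermwiseDerivative.

(** * Derivatives of the gamma quotient *)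

Section GammaQuotDerivative.
Context {R : realType}.

(* The [k]-th derivative of [(x + z) * beta_term x z j] in [z]. *)
Let zterm (x : R) (k j : nat) (z : R) : R :=
  (k == 0%N)%:R * bcoef j x +
  bcoef j x * (x - j%:R) * ((-1) ^+ k * k`!%:R) * ((z + j%:R) ^+ k.+1)^-1.

Let is_derive_zterm x k j (z : R) : 0 < z + j%:R ->
  is_derive z 1 (zterm x k j) (zterm x k.+1 j z).
Proof.
move=> q0; have q0' : z + j%:R != 0 by rewrite gt_eqF.
pose p : {poly R} := ('X + j%:R%:P) ^+ k.+1.
have pE (t : R) : p.[t] = (t + j%:R) ^+ k.+1 by rewrite /p !hornerE.
have pz : p.[z] != 0 by rewrite pE expf_neq0.
have h := is_deriveD (is_derive_cst ((k == 0%N)%:R * bcoef j x) z 1)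
  (is_deriveZ (bcoef j x * (x - j%:R) * ((-1) ^+ k * k`!%:R))
     (is_deriveV pz (is_derive_poly p z))).
have -> : zterm x k j = cst ((k == 0%N)%:R * bcoef j x) +
    (bcoef j x * (x - j%:R) * ((-1) ^+ k * k`!%:R)) \*: (fun t => p.[t]^-1).
  by apply/funext => t; rewrite /zterm -pE.
apply: (is_derive_eq h).
rewrite pE /p deriv_exp derivD derivX derivC addr0 mul1r hornerMn !hornerE/=.
rewrite /zterm mul0r !add0r factS natrM !exprS expr0 -mulr_natr /GRing.scale/=.
by field; rewrite mul1r expf_neq0 q0'.
Qed.

Lemma dist_lt_itv (z c r : R) : `|z - c| < r -> c - r < z < c + r.
Proof. by rewrite ltr_distl. Qed.

Let zmaj (x : R) (k j : nat) : R :=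
  k`!%:R * (2 * `|x| + 4) * 2 ^+ k.+1 * (`|bcoef j x| / j.+1%:R).

(** On this ball z + j >= (j + 1) / 2. For k = 0 the two summands merge into a multiple of (x + z) /
    (z + j). For k > 0 one factor 1 / (z + j) absorbs x - j, another supplies 2 / (j + 1), and the
    others are at most 2. *)
Let zterm_le x k j (z : R) : `|z - 1| < 2^-1 -> `|zterm x k j z| <= zmaj x k j.
Proof.
rewrite /zmaj => /dist_lt_itv/andP[z1 z2]; have j0 := ler0n R j.
have q1 : j.+1%:R / 2 <= z + j%:R by rewrite -natr1; lra.
have q12 : 1 <= 2 * (z + j%:R) by lra.
have q0 : 0 < z + j%:R by lra.
have x0 := normr_ge0 x; have k0 : (0 : R) <= k`!%:R by [].
have iq : (z + j%:R)^-1 <= 2 / j.+1%:R.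
  by rewrite -[leRHS]invrK invfM invrK mulrC lef_pV2 ?posrE ?divr_gt0// mulrC.
have iq2 : (z + j%:R)^-1 <= 2.
  by rewrite -[leLHS]mul1r ler_pdivrMr.
rewrite mulrCA mulrA.
case: k k0 => [|k] k0.
  rewrite /zterm/= expr0 mul1r expr1 fact0 mulr1.
  have -> : 1 * bcoef j x + bcoef j x * (x - j%:R) / (z + j%:R) =
      bcoef j x * ((x + z) * (z + j%:R)^-1) by field; rewrite gt_eqF.
  rewrite normrM -mulrA ler_wpM2l// normrM [`|_^-1|]gtr0_norm ?invr_gt0//.
  have xz : `|x + z| <= `|x| + 2.
    by rewrite (le_trans (ler_normD _ _))// lerD2l gtr0_norm; lra.
  apply: (@le_trans _ _ ((`|x| + 2) * (2 / j.+1%:R))).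
    by rewrite ler_pM// invr_ge0 ltW.
  rewrite mul1r expr1 -mulrA ler_wpM2r ?divr_ge0//; lra.
rewrite /zterm mul0r add0r -[X in `|X|]mulrA -[X in `|X|]mulrA normrM.
rewrite -[leRHS]mulrA ler_wpM2l//.
rewrite !normrM normrX normrN1 expr1n mul1r.
rewrite [`|(k.+1)`!%:R|]ger0_norm// [`|_^-1|]gtr0_norm ?invr_gt0 ?exprn_gt0//.
have xj : `|x - j%:R| <= (2 * `|x| + 4) * (z + j%:R).
  apply: (le_trans (ler_normB _ _)); rewrite [`|j%:R|]ger0_norm//.
  have := ler_wpM2l x0 q12; lra.
have y0 : 0 <= 2 * `|x| + 4 by lra.
rewrite exprS invfM.
apply: (@le_trans _ _ ((2 * `|x| + 4) * ((k.+1)`!%:R * ((z + j%:R) ^+ k.+1)^-1))).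
  rewrite [leRHS]mulrC mulrCA -[leRHS]mulrA ler_wpM2l//.
  rewrite mulrA [leRHS]mulrC ler_wpM2r ?invr_ge0 ?exprn_ge0 ?(ltW q0)//.
  by rewrite ler_pdivrMr.
rewrite mulrA [_ * (k.+1)`!%:R]mulrC -!mulrA ler_wpM2l// ler_wpM2l//.
rewrite exprS invfM [leRHS]mulrA.
have -> : 2 ^+ k.+2 / j.+1%:R = 2 / j.+1%:R * (2 * 2 ^+ k) :> R.
  by rewrite !exprS; ring.
apply: ler_pM => //.
- by rewrite invr_ge0 ltW.
- by rewrite invr_ge0 exprn_ge0// ltW.
- rewrite -exprVn (@le_trans _ _ (2 ^+ k))//.
    by rewrite lerXn2r ?nnegrE ?invr_ge0 ?(ltW q0).
  by rewrite ler_peMl ?exprn_ge0// ler1n.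
Qed.

Definition gammaQuot_term (m j : nat) (x : R) : R :=
  (-1) ^+ m.+1 * m`!%:R * (rfact j.+1 x / (j.+1`!%:R * j.+1%:R ^+ m)).

Lemma derive1n_gammaQuot (x : R) (m : nat) : -1 < x -> (0 < m)%N ->
  derive1n m (gammaQuot x) 1 = limn (series (gammaQuot_term m ^~ x)).
Proof.
move=> x1 m0.
have -> : derive1n m (gammaQuot x) 1 =
    derive1n m (fun z => limn (series (zterm x 0 ^~ z))) 1.
  suff /(near_eq_derive1n m)/nbhs_singleton : {near (1 : R), gammaQuot x =1
    (fun z => limn (series (zterm x 0 ^~ z)))} by [].
  near=> z.
  have z0 : 0 < z by near: z; exact: lt_nbhsr.
  have xz0 : 0 < x + z.
    rewrite -ltrBlDl sub0r; near: z; apply: lt_nbhsr; lra.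
  have h := @lim_seriesZ_real _ _ (x + z) (beta_series_cvg x1 z0).
  rewrite gammaQuotE// -(cvg_lim _ h)//.
  congr (limn (series _)); apply/funext => j; rewrite /beta_term /zterm/=.
  by rewrite expr0 fact0 mulr1 expr1; field; rewrite gt_eqF// ltr_wpDr.
have -> : derive1n m (fun z => limn (series (zterm x 0 ^~ z))) 1 =
    limn (series (zterm x m ^~ 1)).
  apply: (@derive1n_series _ (zterm x) (zmaj x) 1 2^-1).
  - move=> k j z /dist_lt_itv/andP[z1 z2]; apply: is_derive_zterm.
    by have := ler0n R j; lra.
  - by move=> k j z; exact: zterm_le.
  - move=> k; rewrite /zmaj; apply/cvg_ex; eexists; apply: lim_seriesZ_real.
    exact: bcoef_summable.
  - by rewrite subrr normr0.
congr (limn (series _)); apply/funext => j.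
(* The constant part is gone because m > 0. Then [bcoefS] moves the coefficient from index j to j +
   1 and cancels one power of j + 1. *)
rewrite /zterm gtn_eqF// mul0r add0r /gammaQuot_term.
have h := bcoefS j x; rewrite [1 + _]addrC natr1.
have -> : bcoef j x * (x - j%:R) = - (bcoef j.+1 x * j.+1%:R).
  by rewrite h; ring.
rewrite /bcoef; have j0 : j.+1%:R != 0 :> R by rewrite pnatr_eq0.
rewrite [(-1) ^+ m.+1]exprS [_ ^+ m.+1]exprS.
have jm : j.+1%:R ^+ m != 0 :> R by rewrite expf_neq0.
move: (j.+1%:R ^+ m) jm (@fact_neq0 R j.+1) j0 => A A0.
by move: (_`!%:R) (j.+1%:R) => B C B0 C0; field; rewrite A0 B0 C0.
Unshelve. all: by end_near. Qed.
End GammaQuotDerivative.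

(** * Derivatives of rising factorials *)

Section RisingFactorialDerivatives.
Context {R : realType}.

Definition rfact_poly (j : nat) : {poly R} := \prod_(i < j) (i%:R%:P - 'X).

Lemma horner_rfact_poly j x : (rfact_poly j).[x] = rfact j x.
Proof.
rewrite /rfact_poly /rfact horner_prod; apply: eq_bigr => i _.
by rewrite !hornerE.
Qed.

(** Leibniz's rule with a factor of degree one. At k = 0 the truncated [k.-1] is harmless, its
    multiplicity being 0. *)
Lemma derivn_mul_linear (p : {poly R}) (c : R) k :
  (p * (c%:P - 'X))^`(k) = p^`(k) * (c%:P - 'X) - p^`(k.-1) *+ k.
Proof.
elim: k => [|k ih]; first by rewrite !derivn0 mulr0n subr0.
rewrite derivnS ih derivB derivM derivB derivC derivX derivMn -!derivnS sub0r mulrN1.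
by case: k {ih} => [|k] /=; rewrite ?mulr0n ?subr0 ?mulr1n// -addrA -opprD -mulrS.
Qed.

Lemma derivn_rfact_polyS j k x : (rfact_poly j.+1)^`(k).[x] =
  (rfact_poly j)^`(k).[x] * (j%:R - x) - k%:R * (rfact_poly j)^`(k.-1).[x].
Proof.
rewrite {1}/rfact_poly big_ord_recr/= -/(rfact_poly j) derivn_mul_linear.
by rewrite hornerD hornerN hornerMn hornerM !hornerE mulr_natl.
Qed.

(** This is Cauchy's estimate on the disc of radius s, where the product is at most the product of
    the b_i + s. The induction rests on k (k-1)! / s^(k-1) = s (k! / s^k). *)
Lemma derivn_rfact_poly_le (b : nat -> R) (s x : R) j k : 0 < s ->
  (forall i : nat, `|i%:R - x| <= b i) ->
  `|(rfact_poly j)^`(k).[x]| <= k`!%:R / s ^+ k * \prod_(i < j) (b i + s).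
Proof.
move=> s0 bx; have b0 i : 0 <= b i by exact: le_trans (bx i).
have c0 i : (0 : R) <= i`!%:R / s ^+ i by rewrite divr_ge0// exprn_ge0// ltW.
elim: j k => [|j ih] k.
  rewrite /rfact_poly !big_ord0 mulr1; case: k => [|k].
    by rewrite derivn0 hornerC normr1 fact0 expr0 divr1.
  by rewrite derivSn derivC derivnC/= if_same horner0 normr0.
have P0 : 0 <= \prod_(i < j) (b i + s).
  by apply: prodr_ge0 => i _; rewrite addr_ge0// ltW.
rewrite derivn_rfact_polyS big_ord_recr/= (le_trans (ler_normB _ _))//.
rewrite [leRHS]mulrA [leRHS]mulrDr lerD//.
  by rewrite normrM ler_pM.
case: k => [|k]; first by rewrite mul0r normr0 mulr_ge0 ?(ltW s0)// mulr_ge0// c0.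
rewrite normrM normr_nat/= (le_trans (ler_wpM2l _ (ih k)))//.
rewrite factS natrM exprS invfM le_eqVlt; apply/orP; left; apply/eqP.
by field; rewrite ?expf_neq0 ?gt_eqF.
Qed.

End RisingFactorialDerivatives.

(** * Series for the mixed derivatives at n *)

Section FderSeries.
Context {R : realType}.
Variables n m : nat.
Hypothesis m0 : (0 < m)%N.

(* Dominates [rfact j] and, up to a constant, its derivatives on
   [|x - n| < 1 / 4]. *)
Let maj (j : nat) : R := \prod_(i < j) (`|i%:R - n%:R| + 4^-1 + 4^-1).

Let maj_ge0 j : 0 <= maj j.
Proof. by apply: prodr_ge0 => i _; rewrite !addr_ge0. Qed.

(** For j >= n, Raabe's condition reads (j + 1 - n + 1/2) (j + 1) / (j + 2) <= j + 3/4, an equality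
    at j = n = 0; hence y = -3/4. *)
Let maj_summable : cvgn (series (fun j => maj j.+1 / j.+1`!%:R / j.+1%:R)).
Proof.
apply: (@raabe_summable _ _ (- (3 / 4)) n).
- by move=> j; rewrite divr_ge0.
- lra.
move=> j nj; rewrite {1}/maj big_ord_recr/= -/(maj j.+1) [(j.+2)`!]factS natrM.
have nj' : n%:R <= j.+1%:R :> R by rewrite ler_nat (leq_trans nj).
rewrite ger0_norm ?subr_ge0// invfM.
rewrite -[leLHS]mulrA -[leLHS]mulrA -[leRHS]mulrA ler_wpM2l//.
rewrite [X in X <= _](_ : _ = (j.+1`!%:R)^-1 *
  ((j.+1%:R - n%:R + 4^-1 + 4^-1) * j.+1%:R / j.+2%:R)); last by ring.
rewrite ler_wpM2l ?invr_ge0// ler_pdivrMr ?ltr0n// -[j.+2%:R]natr1 -natr1.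
have := ler0n R n; have := ler0n R j => j0 n0.
have := mulr_ge0 n0 j0; nra.
Qed.

Definition Fder_term (i j : nat) (x : R) : R :=
  (-1) ^+ m.+1 * m`!%:R *
  ((rfact_poly j.+1)^`(i).[x] / (j.+1`!%:R * j.+1%:R ^+ m)).

Let Fmaj (i j : nat) : R :=
  m`!%:R * (i`!%:R / 4^-1 ^+ i) * (maj j.+1 / j.+1`!%:R / j.+1%:R).

Let Fder_term_le i j x : `|x - n%:R| < 4^-1 -> `|Fder_term i j x| <= Fmaj i j.
Proof.
move=> xn; rewrite /Fmaj /Fder_term normrM normrM normrX normrN1 expr1n mul1r normr_nat.
rewrite -mulrA ler_wpM2l// normrM normfV normrM normr_nat normrX normr_nat.
rewrite -(mulrA (maj _)) -invfM mulrA; apply: ler_pM => //.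
(* One quarter bounds |x - n|, the other is the radius [s]. *)
- apply: (@derivn_rfact_poly_le _ (fun k => `|k%:R - n%:R| + 4^-1)) => // k.
  by rewrite (le_trans (ler_distD n%:R _ _))// lerD2l distrC ltW.
- rewrite lef_pV2 ?posrE ?mulr_gt0 ?exprn_gt0 ?ltr0n ?fact_gt0//.
  by rewrite ler_pM2l ?ltr0n ?fact_gt0// ler_eXnr// ler1n.
Qed.

Let is_derive_Fder_term i j (x : R) :
  is_derive x 1 (Fder_term i j) (Fder_term i.+1 j x).
Proof.
pose c : R := (-1) ^+ m.+1 * m`!%:R / (j.+1`!%:R * j.+1%:R ^+ m).
have -> : Fder_term i j = c \*: (fun t => (rfact_poly j.+1)^`(i).[t]).
  by apply/funext => t; rewrite /Fder_term /c/= /GRing.scale/=; ring.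
have -> : Fder_term i.+1 j x = c *: ((rfact_poly j.+1)^`(i))^`().[x].
  by rewrite /Fder_term /c derivnS /GRing.scale/=; ring.
exact: (is_deriveZ c (is_derive_poly _ x)).
Qed.

Let Fmaj_summable i : cvgn (series (Fmaj i)).
Proof. by rewrite /Fmaj; apply/cvg_ex; eexists; apply: lim_seriesZ_real. Qed.

Lemma cvg_Fder_term i : cvgn (series (Fder_term i ^~ n%:R)).
Proof.
apply: normed_cvg; apply: (@series_le_cvg _ (fun j => `|Fder_term i j n%:R|)
  (Fmaj i)) => //.
- by move=> j; rewrite !mulr_ge0 ?invr_ge0 ?exprn_ge0.
- by move=> j; apply: Fder_term_le; rewrite subrr normr0.
Qed.

(** The series represents the inner derivative only for x > -1, but agreement near n determines all
    derivatives in x at n. *)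
Lemma FderE i : Fder R i n m = limn (series (Fder_term i ^~ n%:R)).
Proof.
have <- : derive1n i (fun x => limn (series (Fder_term 0 ^~ x))) n%:R =
    limn (series (Fder_term i ^~ n%:R)).
  apply: (@derive1n_series _ Fder_term Fmaj n%:R 4^-1) => //.
  by rewrite subrr normr0.
suff /(near_eq_derive1n i)/nbhs_singleton : {near (n%:R : R),
  (fun x => derive1n m (gammaQuot x) 1) =1
  (fun x => limn (series (Fder_term 0 ^~ x)))} by [].
near=> x.
have x1 : -1 < x.
  by near: x; apply: lt_nbhsr; rewrite (lt_le_trans _ (ler0n _ _))// ltrN10.
rewrite derive1n_gammaQuot//; congr (limn (series _)); apply/funext => j.
by rewrite /gammaQuot_term /Fder_term derivn0 horner_rfact_poly.
Unshelve. all: by end_near. Qed.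

End FderSeries.

(** * Taylor coefficients of rising factorials at n *)

Section RisingFactorialTaylor.
Context {R : realType}.
Local Notation H := (genharm R).

Lemma genharm0 s : H s 0 = 0.
Proof. by rewrite /genharm big_geq. Qed.

Lemma genharmS s k : H s k.+1 = H s k + (k.+1%:R ^+ s)^-1.
Proof. by rewrite /genharm big_nat_recr. Qed.

Variable n : nat.
Local Notation d k j := ((rfact_poly j)^`(k).[n%:R] : R).

(* For [i + j = n] the polynomial is [(-1) ^+ j * (n + e) ... (i + 1 + e)] in
   [e = x - n]; its Taylor coefficients come from the power sums of [1 / l],
   [i < l <= n]. *)
Lemma derivn_rfact_poly_low i j (P := (-1) ^+ j * n`!%:R / i`!%:R : R)
    (e := fun s => H s n - H s i) : (i + j = n)%N ->
  [/\ d 0 j = P, d 1 j = P * e 1%N, d 2 j = P * (e 1%N ^+ 2 - e 2%N) &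
      d 3 j = P * (e 1%N ^+ 3 - 3 * e 1%N * e 2%N + 2 * e 3%N)].
Proof.
rewrite /P /e {P e}; elim: j i => [|j ih] i ijn.
  rewrite addn0 in ijn; rewrite ijn !subrr /rfact_poly big_ord0.
  rewrite /derivn/= !derivC !hornerC expr0 mul1r divff ?fact_neq0//.
  by split; ring.
have [] := ih i.+1; first by rewrite addSnnS.
rewrite !derivn_rfact_polyS [0.-1]/= [1.-1]/= [2.-1]/= [3.-1]/= !genharmS.
move=> -> -> -> ->.
have jn : j%:R - n%:R = - i.+1%:R :> R.
  by rewrite -ijn addnS -addSn natrD opprD addrCA subrr addr0.
rewrite jn factS natrM exprS !mul0r.
have i0 : i.+1%:R != 0 :> R by rewrite pnatr_eq0.
move: (@fact_neq0 R i) i0; move: (i.+1%:R) (i`!%:R) => q f f0 q0.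
by split; field; rewrite ?f0 ?q0.
Qed.

(** With e = x - n, the polynomial is c e times the product of the 1 + e / l for l <= n and of the 1
    - e / l for l <= k. The first two power sums of these slopes are H_n - H_k and H_n2 + H_k2. *)
Lemma derivn_rfact_poly_high k (c := (-1) ^+ n.+1 * n`!%:R * k`!%:R : R) :
  [/\ d 0 (n + k).+1 = 0, d 1 (n + k).+1 = c,
      d 2 (n + k).+1 = 2 * c * (H 1 n - H 1 k) &
      d 3 (n + k).+1 = 3 * c * ((H 1 n - H 1 k) ^+ 2 - H 2 n - H 2 k)].
Proof.
rewrite /c {c}; elim: k => [|k [h0 h1 h2 h3]].
  have [] := @derivn_rfact_poly_low 0 n (add0n n).
  rewrite addn0 !derivn_rfact_polyS [0.-1]/= [1.-1]/= [2.-1]/= [3.-1]/=.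
  rewrite !genharm0 subrr fact0 [(-1) ^+ n.+1]exprS => -> -> -> _.
  by rewrite invr1; split; ring.
rewrite addnS !(derivn_rfact_polyS (n + k).+1) [0.-1]/= [1.-1]/= [2.-1]/=.
rewrite [3.-1]/= h0 h1 h2 h3 !genharmS factS natrM.
have -> : (n + k).+1%:R - n%:R = k.+1%:R :> R by rewrite -addnS natrD addrC addKr.
have k0 : k.+1%:R != 0 :> R by rewrite pnatr_eq0.
by split; field; rewrite ?(addrC 1) ?natr1 ?k0.
Qed.

(** The weights come from the expansion of 1 / ((1 + e) ... (1 + e / n)); the term in the value of
    the polynomial itself is left out. *)
Definition Fcomb (f1 f2 f3 : R) : R :=
  (H 1 n ^+ 2 + H 2 n) * f1 - H 1 n * f2 + 3^-1 * f3.

(* Six times the complete homogeneous symmetric polynomial of degree 3 in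
   [1, 1 / 2, ..., 1 / k]. *)
Definition harm3 (k : nat) : R := H 1 k ^+ 3 + 2 * H 3 k + 3 * H 1 k * H 2 k.

(** The quotient by (1 + e) ... (n + e) is (-1)^j / ((1 + e) ... (n - j + e)), whose e^3 coefficient
    yields [- harm3 (n - j)]; [harm3 n] comes from the omitted value term. *)
Lemma Fcomb_low j : (j <= n)%N -> Fcomb (d 1 j) (d 2 j) (d 3 j) =
  (-1) ^+ j * (n`!%:R / (n - j)`!%:R) * ((harm3 n - harm3 (n - j)) / 3).
Proof.
move=> jn; have [_ -> -> ->] := derivn_rfact_poly_low (subnK jn).
by rewrite /Fcomb /harm3; field; rewrite fact_neq0.
Qed.

Lemma Fcomb_high k : Fcomb (d 1 (n + k).+1) (d 2 (n + k).+1) (d 3 (n + k).+1) =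
  (-1) ^+ n.+1 * n`!%:R * k`!%:R * (H 1 k ^+ 2 - H 2 k).
Proof.
by have [_ -> -> ->] := derivn_rfact_poly_high k; rewrite /Fcomb; field.
Qed.

End RisingFactorialTaylor.

(** * Series tails and the final identity *)

Section SeriesTail.
Context {R : realType}.

Lemma cvg_series_tail (u : nat -> R) (n : nat) (l : R) :
  series u @ \oo --> l ->
  series (fun k => u (n + k)%N) @ \oo --> l - \sum_(0 <= j < n) u j.
Proof.
move=> ul.
have -> : series (fun k => u (n + k)%N) =
    (fun N => series u (N + n)%N - \sum_(0 <= j < n) u j).
  apply/funext => N; rewrite series_addn /series/= addrAC subrr add0r.
  rewrite -{2}[n]add0n big_addn addnK.
  by apply: eq_bigr => k _; rewrite addnC.
apply: cvgB; last exact: cvg_cst.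
by rewrite -(cvg_shiftn n) in ul.
Qed.

End SeriesTail.

(** The exponent is an integer: at k = 0 the left side is the inverse of -1. *)
Lemma sign_pred (R : realType) (k : nat) : (-1) ^ (k%:Z - 1) = - (-1) ^+ k :> R.
Proof.
rewrite expfzDr ?oppr_eq0 ?oner_eq0//.
by rewrite -[X in _ * X]/((-1)^-1) invrN1 mulrN1.
Qed.

Theorem theorem3p3 (R : realType) (n m : nat) (hm : (1 <= m)%N) :
  let H (s k : nat) : R := genharm R s k in
  let F (j : nat) : R := Fder R j n m in
  series (fun k : nat =>
    (H 1%N k ^+ 2 - H 2%N k)
      / ((n + k + 1)%:R ^+ (m + 1) * 'C(n + k, k)%:R)) @ \oo -->
  (-1) ^ (n%:Z - 1) / 3 *
    (\sum_(1 <= k < n.+1)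
      (-1) ^ (k%:Z - 1) / k%:R ^+ m * 'C(n, k)%:R *
        (H 1%N n ^+ 3 + 2 * H 3%N n + 3 * H 1%N n * H 2%N n
         - H 1%N (n - k)%N ^+ 3 - 2 * H 3%N (n - k)%N
         - 3 * H 1%N (n - k)%N * H 2%N (n - k)%N))
  + (-1) ^+ (m + n) / m`!%:R *
    ((H 1%N n ^+ 2 + H 2%N n) * F 1%N - H 1%N n * F 2%N + 3^-1 * F 3%N).
Proof.
move=> H F.
pose T j := (-1) ^+ (m + n) / m`!%:R * Fcomb n (Fder_term m 1 j n%:R)
  (Fder_term m 2 j n%:R) (Fder_term m 3 j n%:R) : R.
have TE j : T j = (-1) ^+ n.+1 / (j.+1`!%:R * j.+1%:R ^+ m) *
    Fcomb n (rfact_poly j.+1)^`(1).[n%:R] (rfact_poly j.+1)^`(2).[n%:R]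
      (rfact_poly j.+1)^`(3).[n%:R].
  rewrite /T /Fcomb /Fder_term !exprD !exprS.
  have jm : j.+1%:R ^+ m != 0 :> R by rewrite expf_neq0// pnatr_eq0.
  have s2 : (-1) ^+ m * (-1) ^+ m = 1 :> R.
    by rewrite -exprMn mulrNN mulr1 expr1n.
  move: s2 jm (@fact_neq0 R m) (@fact_neq0 R j.+1).
  move: ((-1) ^+ m) (j.+1%:R ^+ m) (m`!%:R) (j.+1`!%:R) => s A B C s2 A0 B0 C0.
  (* Inserting s * s = 1 makes the goal an identity of rational functions. *)
  by rewrite -[RHS]mul1r -[X in _ = X * _]s2; field; rewrite A0 B0 C0.
have cT : series T @ \oo --> (-1) ^+ (m + n) / m`!%:R *
    ((H 1%N n ^+ 2 + H 2%N n) * F 1%N - H 1%N n * F 2%N + 3^-1 * F 3%N).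
  have -> : series T = (fun N => (-1) ^+ (m + n) / m`!%:R *
      ((H 1%N n ^+ 2 + H 2%N n) * series (Fder_term m 1 ^~ n%:R) N
       - H 1%N n * series (Fder_term m 2 ^~ n%:R) N
       + 3^-1 * series (Fder_term m 3 ^~ n%:R) N)).
    apply/funext => N; rewrite /series/= !mulr_sumr -sumrB -big_split/= mulr_sumr.
    exact: eq_bigr.
  rewrite /F !FderE//.
  apply: cvgM; first exact: cvg_cst.
  apply: cvgD; [apply: cvgB|]; apply: cvgM; try exact: cvg_cst;
    exact: cvg_Fder_term.
(* [T j] involves the rising factorial of degree j + 1. The indices j < n, of degree at most n, are
   split off as the finite sum, and j = n + k gives the series. *)
have := @cvg_series_tail _ _ n _ cT.
have -> : (fun k => T (n + k)%N) = (fun k : nat => (H 1%N k ^+ 2 - H 2%N k)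
      / ((n + k + 1)%:R ^+ (m + 1) * 'C(n + k, k)%:R)).
  apply/funext => k; rewrite TE Fcomb_high -/(H 1%N k) -/(H 2%N k) !addn1.
  have b := bin_fact (leq_addl n k); rewrite addnK in b.
  rewrite factS -b !natrM [_ ^+ m.+1]exprS.
  have s2 : (-1) ^+ n.+1 * (-1) ^+ n.+1 = 1 :> R.
    by rewrite -exprMn mulrNN mulr1 expr1n.
  have A0 : (n + k)%N.+1%:R ^+ m != 0 :> R by rewrite expf_neq0// pnatr_eq0.
  have q0 : (n + k)%N.+1%:R != 0 :> R by rewrite pnatr_eq0.
  have C0 : 'C(n + k, k)%:R != 0 :> R by rewrite pnatr_eq0 -lt0n bin_gt0 leq_addl.
  move: s2 A0 q0 C0 (@fact_neq0 R k) (@fact_neq0 R n).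
  move: ((-1) ^+ n.+1) ((n + k)%N.+1%:R) (_ ^+ m) ('C(n + k, k)%:R)
    (k`!%:R) (n`!%:R) (H 1%N k ^+ 2 - H 2%N k) => s q A C f g a s2 A0 q0 C0 f0 g0.
  by rewrite -[RHS]mul1r -[X in _ = X * _]s2; field; rewrite A0 q0 C0 f0 g0.
congr (_ --> _).
rewrite addrC; congr (_ + _).
rewrite big_add1/= mulr_sumr -sumrN; apply: eq_big_nat => j /andP[_ jn].
rewrite TE Fcomb_low// !sign_pred.
(* Writing n! as binomial times factorials turns n! / ((j + 1)! (n - j - 1)!) into the binomial
   coefficient of the statement. *)
rewrite -(bin_fact jn) (natrM _ 'C(n, j.+1)) (natrM _ j.+1`!).
have A0 : j.+1%:R ^+ m != 0 :> R by rewrite expf_neq0// pnatr_eq0.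
rewrite [(-1) ^+ n.+1]exprS /harm3 /H.
move: A0 (@fact_neq0 R j.+1) (@fact_neq0 R (n - j.+1)).
move: (j.+1%:R ^+ m) (j.+1`!%:R) ((n - j.+1)`!%:R) => A B C A0 B0 C0.
by field; rewrite A0 B0 C0.
Qed.
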